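(* Let $c\ge2$ be real and let $\{L_n,W_n\}_{n\in\mathbb{Z}}$ be a representation of the $\mathcal{W}_3$-algebra with central charge $c$ on a complex vector space $V$. Let $\Omega\in V$ be a nonzero vector and $\langle\cdot,\cdot\rangle$ an inner product (positive definite Hermitian form) on $V$ such that: (i) $\Omega$ is a cyclic lowest weight vector for the representation with $L_0\Omega=W_0\Omega=0$; (ii) the series $T(z)=\sum_{n\in\mathbb{Z}}L_nz^{-n}$ and $M(z)=\sum_{n\in\mathbb{Z}}W_nz^{-n}$ satisfy $$(p(z)T(z))^\dagger=\overline{p}(z)T(z),\qquad (r(z)M(z))^\dagger=\overline{r}(z)M(z)$$ for all trigonometric polynomials $p,r$ with $p(-1)=r(-1)=r'(-1)=0$. Then $L_n^\dagger=L_{-n}$ and $W_n^\dagger=W_{-n}$ for all $n\in\mathbb{Z}$; consequently, the representation (with the inner product $\langle\cdot,\cdot\rangle$) is unitary.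
   Context: Let $V$ be a complex vector space. A formal series $\sum_{n\in\mathbb{Z}}A_n z^{-n}$ with $A_n\in\mathrm{End}(V)$ is a field on $V$ if for every $v\in V$ there is $n_v$ with $A_nv=0$ for all $n\ge n_v$. A representation of the $\mathcal{W}_3$-algebra with central charge $c\in\mathbb{C}$, $c\ne-\frac{22}{5}$, on $V$ consists of linear operators $\{L_n,W_n\}_{n\in\mathbb{Z}}$ on $V$ such that $L(z)=\sum_n L_nz^{-n-2}$ and $W(z)=\sum_n W_nz^{-n-3}$ are fields and, for all $m,n\in\mathbb{Z}$, $$[L_m,L_n]=(m-n)L_{m+n}+\tfrac{c}{12}m(m^2-1)\delta_{m+n,0},\qquad [L_m,W_n]=(2m-n)W_{m+n},$$ $$[W_m,W_n]=\tfrac{c}{3\cdot5!}(m^2-4)(m^2-1)m\,\delta_{m+n,0}+b^2(m-n)\Lambda_{m+n}+\tfrac{1}{30}(m-n)(2m^2-mn+2n^2-8)L_{m+n},$$ where $b^2=\frac{16}{22+5c}$ and $\Lambda_n=\sum_{k>-2}L_{n-k}L_k+\sum_{k\le-2}L_kL_{n-k}-\frac{3}{10}(n+2)(n+3)L_n$. A nonzero vector $\Omega$ is a lowest weight vector with lowest weight $(h,w)\in\mathbb{C}^2$ if $L_n\Omega=W_n\Omega=0$ for all $n>0$, $L_0\Omega=h\Omega$ and $W_0\Omega=w\Omega$. It is cyclic if the smallest subspace containing $\Omega$ and invariant under all $L_n,W_n$ is $V$. Adjoints: for linear operators $A,B$ on $V$, $B=A^\dagger$ means $\langle Bx,y\rangle=\langle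 x,Ay\rangle$ for all $x,y\in V$. For a formal series $A(z)=\sum_nA_nz^{-n}$, $A(z)^\dagger:=\sum_nA_n^\dagger z^{n}$. A trigonometric polynomial is a finite scalar series $p(z)=\sum_{|n|<N}c_nz^{-n}$, $c_n\in\mathbb{C}$, and $\overline{p}(z):=\sum_{|n|<N}\overline{c_{-n}}\,z^{-n}$; derivatives are along the circle, $r'(z)=iz\,\partial_zr(z)$. Thus $(p(z)T(z))^\dagger=\overline{p}(z)T(z)$ means that $\big(\sum_kc_kL_{n-k}\big)^\dagger=\sum_k\overline{c_{-k}}L_{-n-k}$ for all $n\in\mathbb{Z}$, and similarly for $M$ with $W$ in place of $L$. A representation together with an inner product is unitary if $L_n^\dagger=L_{-n}$ and $W_n^\dagger=W_{-n}$ for all $n\in\mathbb{Z}$. *)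

(* Defs.v *)
From HB Require Import structures.
From mathcomp Require Import all_boot all_order all_algebra.
From mathcomp Require Import all_classical reals.
From mathcomp Require Import complex.
Set Implicit Arguments.
Unset Strict Implicit.
Unset Printing Implicit Defensive.
Import Order.TTheory GRing.Theory Num.Theory.
Local Open Scope classical_set_scope.
Local Open Scope ring_scope.

(* A formal series \sum_n A_n z^{-n} is given by its coefficients, i.e. [A n]
   is the coefficient of z^{-n}, not of z^n.  All infinite sums below are the
   finitely supported sums of fsbigop: they are 0 when the support is infinite,
   which does not happen for fields and trigonometric polynomials. *)

Section Series.
Variables (R : realType) (V : lmodType R[i]).
Implicit Types (A B : int -> V -> V) (p : int -> R[i]).

Definition is_field A :=
  forall v, exists nv : int, forall n, nv <= n -> A n v = 0.

Definition is_trig_poly p :=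
  exists N : nat, forall n : int, (N <= `|n|)%N -> p n = 0.

Definition trig_eval p (z : R[i]) : R[i] := \sum_(n \in [set: int]) p n * z ^ (- n).

Definition trig_conj p : int -> R[i] := fun n => (p (- n))^*.

(* i z d/dz maps z^{-n} to - i n z^{-n} *)
Definition trig_deriv p : int -> R[i] := fun n => - ('i * n%:~R * p n).

Definition trig_mul p A : int -> V -> V :=
  fun n v => \sum_(k \in [set: int]) p k *: A (n - k) v.

(* B = A^dagger; the forms [{dot V for theta}] are linear in the first argument
   and theta-semilinear in the second one. *)
Definition is_adjoint (ip : {dot V for @Num.conj R[i]}) (a b : V -> V) :=
  forall x y, ip (b x) y = ip x (a y).

(* B(z) = A(z)^dagger = \sum_n A_n^dagger z^n *)
Definition is_series_adjoint (ip : {dot V for @Num.conj R[i]}) A B :=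
  forall n, is_adjoint ip (A n) (B (- n)).

End Series.

Section W3.
Variables (R : realType) (V : lmodType R[i]).
Implicit Types (c : R[i]) (L W : int -> {linear V -> V}).

Definition commutator (a b : V -> V) : V -> V := fun v => a (b v) - b (a v).

Definition W3_Lambda L (n : int) : V -> V := fun v =>
  \sum_(k \in [set k : int | -2 < k]) L (n - k) (L k v)
  + \sum_(k \in [set k : int | k <= -2]) L k (L (n - k) v)
  - (3 / 10 * (n%:~R + 2) * (n%:~R + 3)) *: L n v.

Record is_W3_rep c L W : Prop := {
  W3_central_charge : c != - (22 / 5) ;
  W3_L_field : is_field (fun n => L (n - 2)) ;
  W3_W_field : is_field (fun n => W (n - 3)) ;
  W3_LL : forall (m n : int) v, commutator (L m) (L n) v =
    (m - n)%:~R *: L (m + n) v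
    + (c / 12 * m%:~R * (m%:~R ^+ 2 - 1) * (m + n == 0)%:R) *: v ;
  W3_LW : forall (m n : int) v, commutator (L m) (W n) v =
    (2 * m - n)%:~R *: W (m + n) v ;
  W3_WW : forall (m n : int) v, commutator (W m) (W n) v =
    (c / (3 * (5`!)%:R) * (m%:~R ^+ 2 - 4) * (m%:~R ^+ 2 - 1) * m%:~R
       * (m + n == 0)%:R) *: v
    + (16 / (22 + 5 * c) * (m - n)%:~R) *: W3_Lambda L (m + n) v
    + (1 / 30 * (m - n)%:~R * (2 * m ^+ 2 - m * n + 2 * n ^+ 2 - 8)%:~R)
        *: L (m + n) v }.

Record is_lowest_weight L W (h w : R[i]) (Omega : V) : Prop := {
  lw_neq0 : Omega != 0 ;
  lw_L_pos : forall n : int, 0 < n -> L n Omega = 0 ;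
  lw_W_pos : forall n : int, 0 < n -> W n Omega = 0 ;
  lw_L0 : L 0 Omega = h *: Omega ;
  lw_W0 : W 0 Omega = w *: Omega }.

Definition invariant_subspace L W (S : set V) :=
  submod_closed (mem S) /\
  forall (n : int) v, S v -> S (L n v) /\ S (W n v).

Definition is_cyclic L W (Omega : V) :=
  smallest (invariant_subspace L W) [set Omega] = [set: V].

Record is_unitary_W3_rep c L W (ip : {dot V for @Num.conj R[i]}) : Prop := {
  unitary_rep : is_W3_rep c L W ;
  unitary_L : forall n, is_adjoint ip (L n) (L (- n)) ;
  unitary_W : forall n, is_adjoint ip (W n) (W (- n)) }.

End W3.

(* Main.v *)
Require Import Defs.
From HB Require Import structures.
From mathcomp Require Import all_boot all_order all_algebra.
From mathcomp Require Import all_classical reals.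
From mathcomp Require Import complex.
From mathcomp Require Import zify ring.
Set Implicit Arguments.
Unset Strict Implicit.
Unset Printing Implicit Defensive.
Import Order.TTheory GRing.Theory Num.Theory.
Local Open Scope classical_set_scope.
Local Open Scope ring_scope.

(** Write D_n(x, y) = <x, L_n y> - <L_{-n} x, y> and E_n(x, y) likewise for W;
the theorem says that all these forms vanish.  Testing the hypotheses on
trigonometric polynomials with two, respectively three, monomials gives
D_n = (-1)^n D_0, and shows that n |-> (-1)^n E_n is affine in n.  So D is
known from one D_n, and E from two consecutive E_n.

Vanishing on the vacuum.  Let f(y) = <Omega, y>.  Since L_0 Omega = 0, one has
D_0(Omega, y) = f(L_0 y), and D_1 = - D_0 first yields |L_{-1} Omega|^2 = 0,
hence L_{-1} Omega = 0 by positivity, and then f(L_0 y) = - f(L_1 y) for all y.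
If y has energy N > 0, this reads N f(y) = - f(L_1 y), where L_1 y has energy
N - 1.  At N = 1 the vector L_1 y is zero, because the energy 1 space is spanned
by L_{-1} Omega = 0 and W_{-1} Omega, and L_1 W_{-1} Omega = 3 W_0 Omega = 0.  By
induction f vanishes at every nonzero energy.  So D_0(Omega, y) = f(L_0 y) = 0,
and E_{-n}(Omega, y) = f(W_{-n} y) = 0 for n > 0, because W_{-n} y has no
component of energy 0.  The facts on energies at most 1 come from [normal_ordering],
a weak form of the Poincare-Birkhoff-Witt theorem.

Propagation.  Let x satisfy D_n(x, .) = E_n(x, .) = 0 for all n.  Commuting
modes inside <x, . > gives, for A and B among L and W with defects D^A and D^B,
D^B_n(A_a x, .) = D^A_{-a}(B_{-n} x, .) ([defect_exchange]), and the right-hand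
side is zero for n very negative because B is a field.  As D^B is determined by
one or two values of n, it vanishes on A_a x.  For A = B = W this
needs Lambda_k^dagger = Lambda_{-k} on x ([ip_Lambda]).  So such vectors
form an invariant subspace containing Omega, which is everything by cyclicity. *)

(** * Defects of adjointness and trigonometric polynomials *)

Section TrigPoly.
Variables (R : realType) (V : lmodType R[i]).
Implicit Types (s : seq (int * int)) (A : int -> {linear V -> V}).

(** The trigonometric polynomial sum_i a_i (- z)^{-k_i}, for the list of the
pairs (a_i, k_i).  With these signs its value at -1 is the sum of the a_i, its
derivative there is - i times the sum of the a_i k_i, and its coefficients are
real. *)
Definition alt_poly s : int -> R[i] :=
  fun k => \sum_(t <- s) t.1%:~R * (-1) ^ t.2 * (k == t.2)%:R.

Lemma is_trig_alt_poly s : is_trig_poly (alt_poly s).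
Proof.
exists (\max_(t <- s) `|t.2|).+1 => n hn; rewrite /alt_poly big_seq big1 // => t ts.
case: eqP => [nt|_]; last by rewrite mulr0.
by have := @leq_bigmax_seq _ s xpredT (fun t => `|t.2|%N) t ts isT; rewrite -nt leqNgt hn.
Qed.

Lemma sum_alt_poly (U : lmodType R[i]) (F : int -> U) s :
  \sum_(k \in [set: int]) alt_poly s k *: F k =
  \sum_(t <- s) (t.1%:~R * (-1) ^ t.2) *: F t.2.
Proof.
pose r := undup [seq t.2 | t <- s].
rewrite -(@fsbig_widen _ _ _ _ [set` r]) //; last first.
  move=> k [_ /= /negP kr]; rewrite /alt_poly big_seq big1 ?scale0r // => t ts.
  case: eqP => [kt|_]; last by rewrite mulr0.
  by case/negP: kr; rewrite mem_undup kt map_f.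
rewrite -fsbig_seq ?undup_uniq //.
under eq_bigr do rewrite /alt_poly scaler_suml.
rewrite exchange_big /= [LHS]big_seq [RHS]big_seq; apply: eq_bigr => t ts.
rewrite (bigD1_seq t.2) ?undup_uniq ?mem_undup ?map_f //= eqxx mulr1.
by rewrite big1 ?addr0 // => k /negPf ->; rewrite mulr0 scale0r.
Qed.

Lemma signzK (k : int) : (-1) ^ k * (-1) ^ (- k) = 1 :> R[i].
Proof. by rewrite -expfzDr ?subrr ?expr0z // oppr_eq0 oner_eq0. Qed.

Lemma conj_signz (k : int) : ((-1) ^ k)^* = (-1) ^ k :> R[i].
Proof. by rewrite rmorphXz ?rmorphN1 // unitrN1. Qed.

Lemma signzN (k : int) : (-1) ^ (- k) = (-1) ^ k :> R[i].
Proof. by rewrite -exprz_inv invrN1. Qed.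

Lemma alt_poly_eval s :
  trig_eval (alt_poly s) (-1) = (\sum_(t <- s) t.1)%:~R.
Proof.
rewrite /trig_eval (sum_alt_poly (fun n => (-1) ^ (- n) : R[i]^o)) rmorph_sum /=.
by apply: eq_bigr => t _; rewrite /GRing.scale /= -mulrA signzK mulr1.
Qed.

Lemma alt_poly_deriv_eval s :
  trig_eval (trig_deriv (alt_poly s)) (-1) = - 'i * (\sum_(t <- s) t.1 * t.2)%:~R.
Proof.
transitivity (\sum_(n \in [set: int])
    alt_poly s n *: (- ('i * n%:~R) * (-1) ^ (- n) : R[i]^o)).
  by apply: eq_fsbigr => n _; rewrite /trig_deriv /GRing.scale /=; ring.
rewrite sum_alt_poly rmorph_sum mulr_sumr /=.
apply: eq_bigr => t _; rewrite /GRing.scale /= rmorphM /=.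
transitivity (t.1%:~R * ((-1) ^ t.2 * (-1) ^ (- t.2)) * (- ('i * t.2%:~R)) : R[i]).
  by ring.
by rewrite signzK; ring.
Qed.

Lemma conj_alt_poly s :
  trig_conj (alt_poly s) = alt_poly [seq (t.1, - t.2) | t <- s].
Proof.
apply/funext => k; rewrite /trig_conj /alt_poly rmorph_sum big_map /=.
apply: eq_bigr => t _; rewrite !rmorphM /= conj_signz rmorph_int rmorph_nat.
by rewrite signzN eqr_oppLR.
Qed.

(** The form that vanishes identically if and only if A_{-n} is the adjoint of
A_n. *)
Definition defect (ip : {dot V for @Num.conj R[i]}) A (n : int) x y : R[i] :=
  ip x (A n y) - ip (A (- n) x) y.

Lemma defect_alt_poly (ip : {dot V for @Num.conj R[i]}) A s x y :
    is_series_adjoint ip (trig_mul (alt_poly s) A)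
      (trig_mul (trig_conj (alt_poly s)) A) ->
  \sum_(t <- s) t.1%:~R * (-1) ^ t.2 * defect ip A (- t.2) x y = 0.
Proof.
move=> /(_ 0 x y); rewrite oppr0 conj_alt_poly /trig_mul !sum_alt_poly big_map.
rewrite (big_morph (ip^~ y) (linearDl ip y) (linear0l ip y)) linear_sumr.
move=> /esym/eqP; rewrite -subr_eq0 -sumrB => /eqP {2}<-. apply: eq_bigr => t _.
rewrite linearZl_LR linearZr_LR /= /GRing.scale /= !sub0r opprK rmorphM.
by rewrite /= conj_signz rmorph_int signzN mulrBr opprK.
Qed.

(** The witness is (- z)^n - 1, which vanishes at -1. *)
Lemma defect_first_order (ip : {dot V for @Num.conj R[i]}) A n x y :
    (forall p : int -> R[i], is_trig_poly p -> trig_eval p (-1) = 0 ->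
      is_series_adjoint ip (trig_mul p A) (trig_mul (trig_conj p) A)) ->
  defect ip A n x y = (-1) ^ n * defect ip A 0 x y.
Proof.
move=> /(_ (alt_poly [:: (1, - n); (-1, 0)]) (is_trig_alt_poly _)).
rewrite alt_poly_eval !big_cons big_nil addr0 subrr => /(_ erefl).
move=> /(@defect_alt_poly ip A _ x y); rewrite !big_cons big_nil /= opprK oppr0.
rewrite addr0 mul1r rmorphN1 expr0z mulr1 mulN1r => /eqP; rewrite subr_eq0.
move=> /eqP <-; rewrite mulrA.
by rewrite signzK mul1r.
Qed.

(** A function affine in n is zero when it is zero at m and at m - 1.  The
witness expresses its value at n through these two; the coefficients are those
for which the polynomial and its derivative vanish at -1. *)
Lemma defect_second_order (ip : {dot V for @Num.conj R[i]}) A m n x y :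
    (forall r : int -> R[i], is_trig_poly r -> trig_eval r (-1) = 0 ->
      trig_eval (trig_deriv r) (-1) = 0 ->
      is_series_adjoint ip (trig_mul r A) (trig_mul (trig_conj r) A)) ->
  defect ip A m x y = 0 -> defect ip A (m - 1) x y = 0 ->
  defect ip A n x y = 0.
Proof.
pose s := [:: (1, - n); (m - n - 1, - m); (n - m, 1 - m)].
move=> /(_ (alt_poly s) (is_trig_alt_poly _)) + dm dm1.
rewrite alt_poly_eval alt_poly_deriv_eval !big_cons !big_nil /=.
have -> : 1 + (m - n - 1 + (n - m + 0)) = 0 :> int by lia.
have -> : 1 * - n + ((m - n - 1) * - m + ((n - m) * (1 - m) + 0)) = 0 :> int.
  by ring.
rewrite mulr0 => /(_ erefl erefl) /(@defect_alt_poly ip A _ x y).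
rewrite !big_cons big_nil /= !opprK opprB dm dm1 !mulr0 !addr0 mul1r.
by move=> /(congr1 ( *%R ((-1) ^ n))); rewrite mulrA signzK mul1r mulr0.
Qed.

End TrigPoly.

(** * Subspaces as sets *)

Section Subspace.
Variables (R : realType) (V : lmodType R[i]).
Implicit Types (Q : set V).

Definition is_subspace Q :=
  Q 0 /\ forall a u v, Q u -> Q v -> Q (a *: u + v).

Lemma is_subspaceP Q : is_subspace Q <-> submod_closed (mem Q).
Proof.
split=> -[Q0 Qlin]; split.
- exact: mem_set.
- by move=> a u v /set_mem Qu /set_mem Qv; apply/mem_set/Qlin.
- exact: set_mem.
- by move=> a u v Qu Qv; apply/set_mem/Qlin; exact: mem_set.
Qed.

Lemma subspaceZ Q a u : is_subspace Q -> Q u -> Q (a *: u).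
Proof. by case=> Q0 Qlin Qu; rewrite -[_ *: _]addr0; exact: Qlin. Qed.

Lemma subspaceD Q u v : is_subspace Q -> Q u -> Q v -> Q (u + v).
Proof. by case=> Q0 Qlin Qu Qv; rewrite -[u]scale1r; exact: Qlin. Qed.

Lemma subspaceN Q u : is_subspace Q -> Q u -> Q (- u).
Proof. by rewrite -scaleN1r; exact: subspaceZ. Qed.

Lemma subspace_sum Q (I : Type) (r : seq I) (F : I -> V) :
  is_subspace Q -> (forall i, Q (F i)) -> Q (\sum_(i <- r) F i).
Proof.
move=> hQ QF; apply: (big_ind Q) => [|u v|//]; first exact: hQ.1.
exact: subspaceD.
Qed.

Lemma subspace_preim Q (f : {linear V -> V}) : is_subspace Q -> is_subspace (f @^-1` Q).
Proof.
move=> [Q0 Qlin]; split=> [|a u v Qu Qv]; first by rewrite /preimage/= linear0.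
by rewrite /preimage/= linearP; exact: Qlin.
Qed.

End Subspace.

(** * Normal ordering in a lowest weight representation *)

Section Rep.
Variables (R : realType) (V : lmodType R[i]) (c : R[i]) (L W : int -> {linear V -> V}).
Hypothesis hrep : is_W3_rep c L W.

Lemma L_eventually0 v : exists N : nat, forall n : int, N%:Z <= n -> L n v = 0.
Proof.
have [nv hnv] := W3_L_field hrep v; exists `|nv|%N => n hn.
by have := hnv (n + 2); rewrite addrK; apply; lia.
Qed.

Lemma W_eventually0 v : exists N : nat, forall n : int, N%:Z <= n -> W n v = 0.
Proof.
have [nv hnv] := W3_W_field hrep v; exists `|nv|%N => n hn.
by have := hnv (n + 3); rewrite addrK; apply; lia.
Qed.

Lemma fsum_window (P : set int) (F : int -> V) (h : nat -> int) (M : nat) :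
    injective h -> (forall t, P (h t)) ->
    (forall k, P k -> (forall t, (t < M)%N -> k != h t) -> F k = 0) ->
  \sum_(k \in P) F k = \sum_(t < M) F (h t).
Proof.
move=> hinj hP hF; pose r := [seq h t | t <- iota 0 M].
rewrite -(@fsbig_widen _ _ _ _ [set` r]) //=; last first.
- move=> k [Pk /= /negP kr]; apply: hF => // t tM; apply: contraNneq kr => ->.
  by rewrite map_f // mem_iota.
- by move=> k /= /mapP[t _ ->].
rewrite -fsbig_seq; last by rewrite map_inj_uniq // iota_uniq.
by rewrite big_map -[M in iota _ M]subn0 big_mkord.
Qed.

(** The two summation bounds are independent because the adjoint of the first
sum is the second one up to a shift by three terms. *)
Lemma Lambda_window n v : exists M0 : nat, forall M1 M2 : nat,
    (M0 <= M1)%N -> (M0 <= M2)%N ->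
  W3_Lambda L n v = \sum_(t < M1) L (n - (t%:Z - 1)) (L (t%:Z - 1) v)
    + \sum_(t < M2) L (- 2 - t%:Z) (L (n - (- 2 - t%:Z)) v)
    - (3 / 10 * (n%:~R + 2) * (n%:~R + 3)) *: L n v.
Proof.
have [N hN] := L_eventually0 v; exists (N + `|n| + 3)%N => M1 M2 hM1 hM2.
rewrite /W3_Lambda.
rewrite (@fsum_window _ (fun k => L (n - k) (L k v)) (fun t => t%:Z - 1) M1).
- rewrite (@fsum_window _ (fun k => L k (L (n - k) v)) (fun t => - 2 - t%:Z) M2) //.
  + by move=> s t; lia.
  + by move=> t /=; lia.
  + move=> k /= kP kh; rewrite hN ?linear0 //.
    by have := kh `|(- 2 - k)%R|%N; lia.
- by move=> s t; lia.
- by move=> t /=; lia.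
- move=> k /= kP kh; rewrite hN ?linear0 //.
  by have := kh `|(k + 1)%R|%N; lia.
Qed.

(** A generator is coded by its kind, true for W and false for L, and its
mode. *)
Definition gen (a : bool * int) : {linear V -> V} := if a.1 then W a.2 else L a.2.

(** What enters the commutator of two generators, in the form used for the
induction of [normal_ordering]: besides central terms, single modes and, only
when both generators are of kind W, products of two modes of L. *)
Lemma subspace_commutator (Q : set V) a b v : is_subspace Q ->
    (a.2 + b.2 = 0 -> Q v) -> Q (L (a.2 + b.2) v) ->
    Q (gen (a.1 || b.1, a.2 + b.2) v) ->
    (a.1 && b.1 -> forall j, Q (L (a.2 + b.2 - j) (L j v))) ->
  Q (commutator (gen a) (gen b) v).
Proof.
move=> hQ.
have QZ0 e : (a.2 + b.2 = 0 -> Q v) -> Q ((e * (a.2 + b.2 == 0)%:R) *: v).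
  move=> Qv; case: eqP => [/Qv ?|_]; first exact: subspaceZ.
  by rewrite mulr0 scale0r; exact: hQ.1.
case: a b QZ0 => [[] m] [[] n] /= QZ0 Qc QL Qg QLL; rewrite /gen /=.
- rewrite (W3_WW hrep); apply: subspaceD => //; last exact: subspaceZ.
  apply: (subspaceD hQ); [exact: QZ0|apply: subspaceZ] => //.
  have [M /(_ M M) ->] // := Lambda_window (m + n) v.
  apply: (subspaceD hQ); last by apply: (subspaceN hQ); exact: subspaceZ.
  apply: (subspaceD hQ); apply: subspace_sum => // i; first exact: QLL.
  by rewrite -{1}(subKr (m + n) (- 2 - i%:Z)); exact: QLL.
- have -> : commutator (W m) (L n) v = - commutator (L n) (W m) v.
    by rewrite /commutator opprB.
  by rewrite (W3_LW hrep) [n + m]addrC; apply: (subspaceN hQ); exact: subspaceZ.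
- by rewrite (W3_LW hrep); exact: subspaceZ.
- rewrite (W3_LL hrep); apply: (subspaceD hQ); [exact: subspaceZ|exact: QZ0].
Qed.

Variable Omega : V.
Hypothesis hlw : is_lowest_weight L W 0 0 Omega.

Lemma gen_vacuum a : 0 <= a.2 -> gen a Omega = 0.
Proof.
case: a => b n /=; rewrite le_eqVlt /gen => /predU1P[<-|n0] /=.
  by case: b; rewrite ?(lw_L0 hlw) ?(lw_W0 hlw) scale0r.
by case: b; rewrite ?(lw_L_pos hlw) ?(lw_W_pos hlw).
Qed.

Definition act (s : seq (bool * int)) (v : V) : V := foldr (fun a u => gen a u) v s.

Lemma act_cat s t v : act (s ++ t) v = act s (act t v).
Proof. by rewrite /act foldr_cat. Qed.

Lemma act0 s : act s 0 = 0.
Proof. by elim: s => //= a s ->; rewrite linear0. Qed.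

Lemma actD s u v : act s (u + v) = act s u + act s v.
Proof. by elim: s => //= a s ->; rewrite linearD. Qed.

Lemma subspace_act (Q : set V) s : is_subspace Q -> is_subspace (act s @^-1` Q).
Proof.
move=> hQ; elim: s Q hQ => [//|a s IHs] Q hQ.
exact: (IHs (gen a @^-1` Q)) (subspace_preim _ hQ).
Qed.

Definition mode (s : seq (bool * int)) : int := \sum_(a <- s) a.2.
(** A generator L counts for one and W for two, so that every term of a
commutator counts for strictly less than the product of its two arguments. *)
Definition weight (s : seq (bool * int)) : nat := \sum_(a <- s) a.1.+1.

Lemma mode0 : mode [::] = 0.
Proof. exact: big_nil. Qed.

Lemma weight0 : weight [::] = 0%N.
Proof. exact: big_nil. Qed.

Lemma mode_cons a s : mode (a :: s) = a.2 + mode s.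
Proof. exact: big_cons. Qed.

Lemma mode_cat s t : mode (s ++ t) = mode s + mode t.
Proof. exact: big_cat. Qed.

Lemma weight_cons a s : weight (a :: s) = (a.1.+1 + weight s)%N.
Proof. exact: big_cons. Qed.

Lemma weight_cat s t : weight (s ++ t) = (weight s + weight t)%N.
Proof. exact: big_cat. Qed.

Let monoE := (mode0, mode_cons, mode_cat, weight0, weight_cons, weight_cat).

(** A generator of mode at least 0 can be moved to the right until it kills
Omega; the commutators produced on the way have the same total mode and a
smaller weight, so they are covered by induction.  The lemma is used for total
modes at least -1, where very few products of negative modes exist. *)
Lemma normal_ordering (Q : set V) N : is_subspace Q ->
    (forall s, all (fun a => a.2 < 0) s -> mode s = N -> Q (act s Omega)) ->
  forall s, mode s = N -> Q (act s Omega).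
Proof.
move=> hQ Qneg s; have [k] := ubnP (weight s); elim: k s => // k IHk s.
have [/Qneg //|/allPn[a + a_ge0]] := boolP (all (fun a => a.2 < 0) s).
rewrite -leNgt in a_ge0; move=> /path.splitPr[pre post].
elim: post pre => [|b post IHpost] pre szk modeN.
  by rewrite act_cat /= gen_vacuum // act0; exact: hQ.1.
have -> : act (pre ++ a :: b :: post) Omega =
    act (rcons pre b ++ a :: post) Omega
    + act pre (commutator (gen a) (gen b) (act post Omega)).
  by rewrite -cats1 !act_cat -actD /= addrC subrK.
move: szk modeN; rewrite !monoE /= => szk modeN.
apply: subspaceD => //.
  by apply: IHpost; rewrite -cats1 !monoE /=; lia.
have IH t : (weight t < weight (a :: b :: post))%N -> mode t = mode (a :: b :: post) ->
    Q (act pre (act t Omega)).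
  rewrite !monoE /= => szt modet; rewrite -act_cat.
  by apply: IHk; rewrite !monoE; lia.
apply: (subspace_commutator (Q := act pre @^-1` Q)) => [|ab0|||ab j].
- exact: subspace_act.
- by apply: IH; rewrite !monoE /= ?addrA ?ab0 ?add0r //; lia.
- by apply: (IH ((false, a.2 + b.2) :: post)); rewrite !monoE /=; lia.
- apply: (IH ((a.1 || b.1, a.2 + b.2) :: post)); rewrite !monoE /=; last lia.
  by case: (a.1); case: (b.1) => /=; lia.
- apply: (IH ((false, a.2 + b.2 - j) :: (false, j) :: post)).
    by move: ab => /andP[a1 b1]; rewrite !monoE a1 b1 /=; lia.
  by rewrite !monoE /=; lia.
Qed.

Lemma mode_le_size s : all (fun a : bool * int => a.2 < 0) s -> mode s <= - (size s)%:Z.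
Proof.
elim: s => [|a s IHs] /=; first by rewrite /mode big_nil.
by move=> /andP[a0 /IHs]; rewrite mode_cons; lia.
Qed.

(** The energy is minus the total mode, so this says that there is no negative
energy: a product of negative modes has negative total mode. *)
Lemma act_pos_mode s : 0 < mode s -> act s Omega = 0.
Proof.
move=> s0; apply: (@normal_ordering [set 0] (mode s)) => //.
  by split=> //= a u v -> ->; rewrite scaler0 addr0.
by move=> t /mode_le_size ht tE; lia.
Qed.

(** The only products of negative modes with sum -1 are L_{-1} and W_{-1}, and
L_1 W_{-1} Omega = 3 W_0 Omega = 0. *)
Lemma L1_act_mode s : L (-1) Omega = 0 -> mode s = -1 -> L 1 (act s Omega) = 0.
Proof.
move=> LOm; apply: (@normal_ordering (L 1 @^-1` [set 0])) => {s}.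
  apply: subspace_preim; split=> //= a u v -> ->; rewrite scaler0 addr0 //.
move=> [|a [|b s]] hs hm; first by move: hm; rewrite /mode big_nil.
  move: a hm {hs} => [[] n]; rewrite /mode big_seq1 /= => ->; rewrite /gen /preimage /=.
    have := W3_LW hrep 1 (-1) Omega; rewrite /commutator (lw_L_pos hlw) //.
    by rewrite linear0 subr0 subrr (lw_W0 hlw) scale0r scaler0.
  by rewrite LOm linear0.
by have := mode_le_size hs; rewrite hm /=; lia.
Qed.

Lemma L0_act s : L 0 (act s Omega) = (- mode s)%:~R *: act s Omega.
Proof.
elim: s => [|a s IHs] /=; first by rewrite (lw_L0 hlw) /mode big_nil oppr0 !scale0r.
have : commutator (L 0) (gen a) (act s Omega) = (- a.2)%:~R *: gen a (act s Omega).
  case: a => [[] n] /=; rewrite /gen /= ?(W3_LL hrep) ?(W3_LW hrep) ?mulr0.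
    by rewrite sub0r add0r.
  by rewrite !(mul0r, mulr0, scale0r) sub0r add0r addr0.
rewrite /commutator IHs linearZ /= => /(canRL (subrK _)) ->.
by rewrite -scalerDl -rmorphD /= mode_cons opprD.
Qed.

Hypothesis hcyc : is_cyclic L W Omega.

Lemma monomials_span (Q : set V) : is_subspace Q ->
  (forall s, Q (act s Omega)) -> forall v, Q v.
Proof.
move=> hQ Qact v.
pose S := [set u | forall P : set V, is_subspace P -> (forall s, P (act s Omega)) -> P u].
suff /(_ v I) : [set: V] `<=` S by apply.
rewrite -hcyc; apply: smallest_sub; last by move=> _ -> P hP /(_ [::]).
split.
  apply: (is_subspaceP S).1; split=> [P hP _|a u w Su Sw P hP Pact]; first exact: hP.1.
  by apply: hP.2; [exact: Su|exact: Sw].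
move=> n u Su; split=> P hP Pact.
  apply: (Su (L n @^-1` P)); first exact: subspace_preim.
  by move=> s; exact: (Pact ((false, n) :: s)).
apply: (Su (W n @^-1` P)); first exact: subspace_preim.
by move=> s; exact: (Pact ((true, n) :: s)).
Qed.

End Rep.

(** * Vectors on which the modes have the expected adjoints *)

Section Unitarity.
Variables (R : realType) (c : R) (V : lmodType R[i]) (L W : int -> {linear V -> V}).
Variables (Omega : V) (ip : {dot V for @Num.conj R[i]}).
Hypothesis hrep : is_W3_rep c%:C%C L W.

Lemma ipZl a x y : ip (a *: x) y = a * ip x y.
Proof. exact: linearZl_LR. Qed.

Lemma ipZr_real a x y : a \is Num.real -> ip x (a *: y) = a * ip x y.
Proof. by move=> /conj_Creal aR; rewrite linearZr_LR /= /GRing.scale /= aR. Qed.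

Lemma real_c : c%:C%C \is Num.real.
Proof. by rewrite complex_real. Qed.

Let realE := (rpredM, rpredB, rpredD, rpredX, rpredV, realz, realn, rpred1, real_c).

Definition adjoint_at (A : int -> {linear V -> V}) x :=
  forall n y, ip x (A n y) = ip (A (- n) x) y.

Lemma adjoint_atP A x : adjoint_at A x <-> forall n y, defect ip A n x y = 0.
Proof.
split=> h n y; first by rewrite /defect h subrr.
by apply/eqP; rewrite -subr_eq0; apply/eqP/h.
Qed.

(** The vector A_a x is traded for B_{-n} x, which is zero for n very negative
when B is a field. *)
Lemma defect_exchange A B a n x y : adjoint_at A x -> adjoint_at B x ->
    ip x (commutator (A (- a)) (B n) y) = ip (commutator (B (- n)) (A a) x) y ->
  defect ip B n (A a x) y = defect ip A (- a) (B (- n) x) y.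
Proof.
move=> hA hB; rewrite /commutator linearBr linearBl /= hA opprK hB => e.
rewrite /defect opprK.
have -> : ip (A a x) (B n y) = ip (B (- n) (A a x)) y - ip (A a (B (- n) x)) y
    + ip (B (- n) x) (A (- a) y) by rewrite -e subrK.
ring.
Qed.

Lemma ip_commutator_LL x y m n : adjoint_at L x ->
  ip x (commutator (L (- m)) (L n) y) = ip (commutator (L (- n)) (L m) x) y.
Proof.
move=> hL; rewrite !(W3_LL hrep) linearDr linearDl /= !ipZr_real ?realE //.
have [->|nm] := eqVneq n m; first by rewrite !ipZl hL opprD opprK [- m + m]addrC.
have -> : (- m + n == 0) = false by apply/eqP; lia.
have -> : (- n + m == 0) = false by apply/eqP; lia.
by rewrite !mulr0 !ipZl !mul0r hL opprD opprK (addrC m) (addrC (- m)).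
Qed.

Lemma ip_commutator_LW x y m n : adjoint_at W x ->
  ip x (commutator (L (- m)) (W n) y) = ip (commutator (W (- n)) (L m) x) y.
Proof.
move=> hW; rewrite -[commutator (W _) _ _]opprK [- commutator _ _ _]opprB.
rewrite -[_ - _]/(commutator (L m) (W (- n)) x) !(W3_LW hrep) linearNl /=.
rewrite ipZr_real ?realE // ipZl hW opprD opprK -mulNr -rmorphN.
by congr (_%:~R * _); ring.
Qed.

Lemma ip_sum_LL x y (n : nat) (f g : nat -> int) :
    adjoint_at L x -> (forall a, adjoint_at L (L a x)) ->
  ip x (\sum_(t < n) L (f t) (L (g t) y)) =
  ip (\sum_(t < n) L (- g t) (L (- f t) x)) y.
Proof.
move=> hL hLL; elim: n => [|n IHn]; first by rewrite !big_ord0 linear0r linear0l.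
by rewrite !big_ord_recr /= linearDr linearDl /= IHn hL hLL.
Qed.

(** Taking adjoints in Lambda_k moves exactly the three products with a factor
L_{-1}, L_0 or L_1 out of normal order.  Reordering them costs no central term,
only 3 k L_{-k}, which is the change of the linear correction
3/10 (k + 2) (k + 3) under k |-> - k. *)
Lemma ip_Lambda x y k : adjoint_at L x -> (forall a, adjoint_at L (L a x)) ->
  ip x (W3_Lambda L k y) = ip (W3_Lambda L (- k) x) y.
Proof.
move=> hL hLL.
have [M1 h1] := Lambda_window hrep k y; have [M2 h2] := Lambda_window hrep (- k) x.
pose M := maxn M1 M2.
have -> : W3_Lambda L k y = \sum_(t < M.+3) L (k - (t%:Z - 1)) (L (t%:Z - 1) y)
    + \sum_(t < M) L (- 2 - t%:Z) (L (k - (- 2 - t%:Z)) y)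
    - (3 / 10 * (k%:~R + 2) * (k%:~R + 3)) *: L k y by apply: h1; lia.
have -> : W3_Lambda L (- k) x =
    \sum_(t < M.+3) L (- k - (t%:Z - 1)) (L (t%:Z - 1) x)
    + \sum_(t < M) L (- 2 - t%:Z) (L (- k - (- 2 - t%:Z)) x)
    - (3 / 10 * ((- k)%:~R + 2) * ((- k)%:~R + 3)) *: L (- k) x by apply: h2; lia.
rewrite linearBr linearDr /= ipZr_real ?realE // hL -ipZl.
rewrite (ip_sum_LL y _ (fun t => k - (t%:Z - 1)) (fun t => t%:Z - 1)) //.
rewrite (ip_sum_LL y _ (fun t => - 2 - t%:Z) (fun t => k - (- 2 - t%:Z))) //.
rewrite -linearDl -linearBl.
congr (ip _ y).
have LL a b a' b' : a = a' -> b = b' -> L a (L b x) = L a' (L b' x) by move=> -> ->.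
have -> : \sum_(t < M.+3) L (- (t%:Z - 1)) (L (- (k - (t%:Z - 1))) x) =
    L 1 (L (- k - 1) x) + L 0 (L (- k) x) + L (-1) (L (- k + 1) x)
    + \sum_(t < M) L (- 2 - t%:Z) (L (- k - (- 2 - t%:Z)) x).
  rewrite !big_ord_recl !addrA; congr (_ + _ + _ + _);
    last (apply: eq_bigr => t _); by apply: LL; rewrite /= /bump; lia.
have -> : \sum_(t < M.+3) L (- k - (t%:Z - 1)) (L (t%:Z - 1) x) =
    L (- k + 1) (L (-1) x) + L (- k) (L 0 x) + L (- k - 1) (L 1 x)
    + \sum_(t < M) L (- (k - (- 2 - t%:Z))) (L (- (- 2 - t%:Z)) x).
  rewrite !big_ord_recl !addrA; congr (_ + _ + _ + _);
    last (apply: eq_bigr => t _); by apply: LL; rewrite /= /bump; lia.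
(* The hypothesis says that the central term vanishes, i.e. m is -1, 0 or 1. *)
have sl2 m n : m%:~R * (m%:~R ^+ 2 - 1) = 0 :> R[i] ->
    L m (L n x) = L n (L m x) + (m - n)%:~R *: L (m + n) x.
  move=> m0; have := W3_LL hrep m n x; rewrite -[_ * _ * (_ - 1)]mulrA m0.
  rewrite mulr0 mul0r scale0r addr0 => /(canRL (subrK _)) ->.
  by rewrite addrC.
rewrite (sl2 1) ?(sl2 0) ?(sl2 (-1)); try by ring.
have -> : 1 + (- k - 1) = - k by ring.
have -> : - 1 + (- k + 1) = - k by ring.
rewrite (add0r (- k)).
have coef : (1 - (- k - 1))%:~R *: L (- k) x + (0 - - k)%:~R *: L (- k) x
      + (- 1 - (- k + 1))%:~R *: L (- k) x
      - (3 / 10 * (k%:~R + 2) * (k%:~R + 3)) *: L (- k) x =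
    - ((3 / 10 * ((- k)%:~R + 2) * ((- k)%:~R + 3)) *: L (- k) x).
  rewrite -!scaleNr -!scalerDl; congr (_ *: _).
  by rewrite /GRing.scale /= !(rmorphB, rmorphD, rmorphN, rmorph0, rmorph1) /=; field.
rewrite -coef !addrA.
by rewrite [LHS](ACl (5*3*1*8*7*2*4*6*9)).
Qed.

Lemma ip_commutator_WW x y m n : adjoint_at L x -> (forall a, adjoint_at L (L a x)) ->
  ip x (commutator (W (- m)) (W n) y) = ip (commutator (W (- n)) (W m) x) y.
Proof.
move=> hL hLL; rewrite !(W3_WW hrep) !(linearDr, linearDl) /= !ipZr_real ?realE //.
have -> : - m - n = - n - m by rewrite addrC.
rewrite !ipZl hL ip_Lambda //; have -> : - (- m + n) = - n + m by lia.
congr (_ + _ + _ * _ * _).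
  have [->|nm] := eqVneq n m; first by rewrite [- m + m]addrC.
  have -> : (- m + n == 0) = false by apply/eqP; lia.
  have -> : (- n + m == 0) = false by apply/eqP; lia.
  by rewrite !mulr0.
by congr (_%:~R); ring.
Qed.

Hypothesis defect_L : forall n x y, defect ip L n x y = (-1) ^ n * defect ip L 0 x y.
Hypothesis defect_W : forall m n x y, defect ip W m x y = 0 ->
  defect ip W (m - 1) x y = 0 -> defect ip W n x y = 0.

Lemma defect_L_eq0 m n x y : defect ip L m x y = 0 -> defect ip L n x y = 0.
Proof.
rewrite defect_L (defect_L n) => /eqP; rewrite mulf_eq0 expfz_eq0.
by rewrite oppr_eq0 oner_eq0 andbF /= => /eqP ->; rewrite mulr0.
Qed.

Lemma defect0l (A : int -> {linear V -> V}) n y : defect ip A n 0 y = 0.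
Proof. by rewrite /defect linear0 !linear0l subrr. Qed.

Definition adjoint_vector (x : V) := adjoint_at L x /\ adjoint_at W x.

(** For L_a x both defects are exchanged for those of L on L_{-n} x and on
W_{-n} x, which are zero for n very negative. *)
Lemma adjoint_vector_L a x : adjoint_vector x -> adjoint_vector (L a x).
Proof.
move=> [hL hW]; split; apply/adjoint_atP => n y.
  have [N hN] := L_eventually0 hrep x.
  apply: (@defect_L_eq0 (- N%:Z)); rewrite (defect_exchange hL) //.
    by rewrite opprK hN // defect0l.
  exact: ip_commutator_LL.
have [N hN] := W_eventually0 hrep x.
have dW m : N%:Z <= - m -> defect ip W m (L a x) y = 0.
  move=> hm; rewrite (defect_exchange hL) ?hN ?defect0l //.
  exact: ip_commutator_LW.
by apply: (@defect_W (- N%:Z)); apply: dW; lia.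
Qed.

Lemma adjoint_vector_W a x : adjoint_vector x -> adjoint_vector (W a x).
Proof.
move=> hx; have [hL hW] := hx; split; apply/adjoint_atP => n y; last first.
  have [N hN] := W_eventually0 hrep x.
  have dW m : N%:Z <= - m -> defect ip W m (W a x) y = 0.
    move=> hm; rewrite (defect_exchange hW) ?hN ?defect0l //.
    by apply: ip_commutator_WW => // b; have [] := adjoint_vector_L b hx.
  by apply: (@defect_W (- N%:Z)); apply: dW; lia.
(* D_0(W_a x, .) is the right-hand side of an exchange whose left-hand side is
   E_{-a}(L_0 x, .), and L_0 x is already known to be an adjoint vector. *)
apply: (@defect_L_eq0 0); rewrite -[a in W a]opprK -(oppr0).
rewrite -(@defect_exchange L W 0 (- a)) ?oppr0 ?opprK //.
  exact: (adjoint_atP _ _).1 (adjoint_vector_L 0 hx).2 _ _.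
have := @ip_commutator_LW x y 0 (- a) hW.
by rewrite oppr0 opprK.
Qed.

Hypothesis hlw : is_lowest_weight L W 0 0 Omega.
Hypothesis hcyc : is_cyclic L W Omega.

Let L_Omega n : 0 <= n -> L n Omega = 0.
Proof. exact: (gen_vacuum hlw (a := (false, n))). Qed.

Let W_Omega n : 0 <= n -> W n Omega = 0.
Proof. exact: (gen_vacuum hlw (a := (true, n))). Qed.

Lemma defect_Omega_L0 y : defect ip L 0 Omega y = ip Omega (L 0 y).
Proof. by rewrite /defect oppr0 L_Omega // linear0l subr0. Qed.

(** Its squared norm is - D_1(Omega, L_{-1} Omega) = D_0(Omega, L_{-1} Omega)
= <Omega, L_{-1} Omega> = D_{-1}(Omega, Omega) = - D_0(Omega, Omega) = 0. *)
Lemma LN1_Omega : L (-1) Omega = 0.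
Proof.
have eig : L 0 (L (-1) Omega) = L (-1) Omega.
  have := L0_act hrep hlw [:: (false, -1)].
  by rewrite /mode big_seq1 /= scale1r.
have ipOm : ip Omega (L (-1) Omega) = 0.
  have /eqP : defect ip L (-1) Omega Omega = 0.
    by apply: (@defect_L_eq0 0); rewrite defect_Omega_L0 L_Omega // linear0r.
  by rewrite /defect opprK (L_Omega (n := 1)) // linear0l subr0 => /eqP.
have : defect ip L 1 Omega (L (-1) Omega) = 0.
  by apply: (@defect_L_eq0 0); rewrite defect_Omega_L0 eig.
rewrite /defect; have -> : L 1 (L (-1) Omega) = 0.
  have := W3_LL hrep 1 (-1) Omega; rewrite /commutator (L_Omega (n := 1)) // linear0 subr0 => ->.
  by rewrite subrr L_Omega // scaler0 add0r expr1n subrr !(mulr0, mul0r) scale0r.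
by rewrite linear0r sub0r => /eqP; rewrite oppr_eq0 dnorm_eq0 => /eqP.
Qed.

(** Both sides are D_0(Omega, y); the right-hand one as - D_1(Omega, y), where
the term with L_{-1} Omega has dropped out. *)
Lemma ip_Omega_L01 y : ip Omega (L 0 y) = - ip Omega (L 1 y).
Proof.
rewrite -defect_Omega_L0; have := defect_L 1 Omega y.
by rewrite expr1z mulN1r {1}/defect LN1_Omega linear0l subr0 => ->; rewrite opprK.
Qed.

(** Energies are orthogonal to the vacuum: induction on the energy N, using
N <Omega, y> = <Omega, L_0 y> = - <Omega, L_1 y>.  At N = 1 the right-hand side
is zero by [L1_act_mode], since energy 0 is not covered by the induction. *)
Lemma ip_Omega_act s : mode s != 0 -> ip Omega (act L W s Omega) = 0.
Proof.
have [|s_le0] := ltP 0 (mode s); first by move/(act_pos_mode hrep hlw) ->; rewrite linear0r.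
have [k kE] : exists k : nat, mode s = - k%:Z by exists `|mode s|%N; lia.
elim: k s kE {s_le0} => [s ->|k IHk s kE _]; first by rewrite oppr0 eqxx.
have k0 : k.+1%:~R != 0 :> R[i] by rewrite intr_eq0.
apply: (mulfI k0); rewrite mulr0 -ipZr_real ?realz //.
have -> : k.+1%:~R *: act L W s Omega = L 0 (act L W s Omega).
  by rewrite (L0_act hrep hlw) kE opprK.
rewrite ip_Omega_L01; case: k IHk kE {k0} => [|k] IHk kE.
  by rewrite (L1_act_mode hrep hlw LN1_Omega kE) linear0r oppr0.
rewrite (IHk ((false, 1) :: s)) ?oppr0 //; rewrite mode_cons kE /=; lia.
Qed.

Lemma adjoint_vector_Omega : adjoint_vector Omega.
Proof.
have ipOm (A : {linear V -> V}) :
    (forall s, ip Omega (A (act L W s Omega)) = 0) -> forall y, ip Omega (A y) = 0.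
  move=> hA; apply: (@monomials_span _ _ _ _ _ hcyc [set y | ip Omega (A y) = 0]) => //=.
  split=> [|a u v /= hu hv]; first by rewrite /= linear0 linear0r.
  by rewrite linearP linearPr /= hu hv mulr0 addr0.
split; apply/adjoint_atP => n y.
  apply: (@defect_L_eq0 0); rewrite defect_Omega_L0; apply: ipOm => s.
  rewrite (L0_act hrep hlw) ipZr_real ?realz //.
  have [->|s0] := eqVneq (mode s) 0; first by rewrite oppr0 mul0r.
  by rewrite ip_Omega_act // mulr0.
have dW m : m < 0 -> defect ip W m Omega y = 0.
  move=> m0; rewrite /defect W_Omega ?linear0l ?subr0; last lia.
  apply: ipOm => s; have [s_gt0|s_le0] := ltP 0 (mode s).
    by rewrite (act_pos_mode hrep hlw) // linear0 linear0r.
  by apply: (@ip_Omega_act ((true, m) :: s)); rewrite mode_cons /=; lia.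
by apply: (@defect_W (-1)); apply: dW.
Qed.

Lemma adjoint_vectorT x : adjoint_vector x.
Proof.
apply: (@monomials_span _ _ _ _ _ hcyc adjoint_vector) => [|s].
  split; [split=> n y|move=> a u v [uL uW] [vL vW]; split=> n y].
  - by rewrite linear0 !linear0l.
  - by rewrite linear0 !linear0l.
  - by rewrite linearP !linearPl /= uL vL.
  - by rewrite linearP !linearPl /= uW vW.
elim: s => [|[[] n] s IHs] /=; first exact: adjoint_vector_Omega.
  exact: adjoint_vector_W.
exact: adjoint_vector_L.
Qed.

End Unitarity.

Theorem theorem3p8 (R : realType) (c : R) (V : lmodType R[i])
    (L W : int -> {linear V -> V}) (Omega : V)
    (ip : {dot V for @Num.conj R[i]})
    (hc : 2 <= c)
    (hrep : is_W3_rep c%:C%C L W)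
    (hlw : is_lowest_weight L W 0 0 Omega)
    (hcyc : is_cyclic L W Omega)
    (hT : forall p : int -> R[i], is_trig_poly p -> trig_eval p (-1) = 0 ->
      is_series_adjoint ip (trig_mul p L) (trig_mul (trig_conj p) L))
    (hM : forall r : int -> R[i], is_trig_poly r -> trig_eval r (-1) = 0 ->
      trig_eval (trig_deriv r) (-1) = 0 ->
      is_series_adjoint ip (trig_mul r W) (trig_mul (trig_conj r) W)) :
  [/\ forall n : int, is_adjoint ip (L n) (L (- n)),
      forall n : int, is_adjoint ip (W n) (W (- n))
    & is_unitary_W3_rep c%:C%C L W ip].
Proof.
have defL n x y := @defect_first_order _ _ ip L n x y hT.
have defW m n x y := @defect_second_order _ _ ip W m n x y hM.
have adj x := adjoint_vectorT hrep defL defW hlw hcyc x.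
have adjL n : is_adjoint ip (L n) (L (- n)).
  by move=> x y; have [-> _] := adj x.
have adjW n : is_adjoint ip (W n) (W (- n)).
  by move=> x y; have [_ ->] := adj x.
by split.
Qed.
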